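(* Let $x,y\in\mathcal S$ be stable g-allocations with $x\prec_F y$. Then there exists $x'\in\mathcal S_x$ such that $x'\preceq_F y$, where $\mathcal S_x:=\{x+\chi^{L^+}-\chi^{L^-}: L\in\mathcal L(x)\}$ is the set of g-allocations obtained from $x$ by shifting with weight 1 along the rotations generated by $x$.
   Context: Setting. $G=(V,E)$ is a finite connected bipartite graph without multiple edges, $V$ partitioned into independent sets $W$ (workers) and $F$ (firms). $E_v$ is the set of edges incident to $v$; $wf$ denotes the edge joining $w\in W$, $f\in F$. There are capacities $b:E\to\mathbb Z_+$ and quotas $q:W\to\mathbb Z_+$. $\mathcal B=\{x\in\mathbb Z_+^E: x\le b\}$; $\mathcal B_v$ is the set of restrictions of members of $\mathcal B$ to $E_v$; $x_v$ is the restriction of $x$ to $E_v$. For $z\ge 0$, $|z|=\sum_e z(e)$. $\wedge,\vee$ are coordinatewise min and max; $\mathbf 1^e$ is the unit vector of $e$; $\mathrm{supp}(z)=\{e: z(e)\neq 0\}$. Choice functions $C_v:\mathcal B_v\to\mathcal B_v$. Each $w\in W$ has a strict linear order $>_w$ on $E_w$ ($e>_w e'$: $e$ is preferred to $e'$), and $C_w(z)=z$ if $|z|\le q(w)$; if $|z|>q(w)$, number $E_w$ as $e_1>_we_2>_w\cdots$, take the maximal $j$ with $r:=\sum_{i\le j}z(e_i)\le q(w)$ and let $C_w(z)=(z(e_1),\ldots,z(e_j),q(w)-r,0,\ldots,0)$. Each $f\in F$ has a $C_f$ with $C_f(z)\le z$ such that for all $z\ge z'$ in $\mathcal B_f$: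 (A1) $z'\ge C_f(z)$ implies $C_f(z')=C_f(z)$; (A2) $C_f(z)\wedge z'\le C_f(z')$; (A3) $|C_f(z)|\ge|C_f(z')|$. $\mathcal A_v=\{z\in\mathcal B_v: C_v(z)=z\}$ (acceptable). For distinct $z,z'\in\mathcal A_v$: $z'\prec_v z$ iff $C_v(z\vee z')=z$. A g-allocation is $x\in\mathcal B$ with $x_v\in\mathcal A_v$ for all $v\in V$. For distinct g-allocations, $x\prec_F y$ iff $x_f\preceq_f y_f$ for all $f\in F$. For $z\in\mathcal A_v$, $e\in E_v$ is interesting for $v$ under $z$ if there is $z'\in\mathcal B_v$ with $z'(e)>z(e)$, $z'(e')=z(e')$ for $e'\ne e$, and $C_v(z')(e)>z(e)$; ''interesting for $v$ under $x$'' means under $x_v$. An edge $wf$ blocks $x$ if it is interesting under $x$ for both $w$ and $f$. A g-allocation is stable if no edge blocks it; $\mathcal S$ is the set of stable g-allocations. It is known that $(\mathcal S,\prec_F)$ is a nonempty distributive lattice, that $x\prec_F y$ in $\mathcal S$ implies $C_w(x_w\vee y_w)=x_w$ for all $w\in W$, and that $|x_v|$ is the same for all $x\in\mathcal S$, for each $v\in V$. Rotations. Let $x\in\mathcal S$ and $W^==\{w\in W:|x_w|=q(w)\}$. For $w\in W^=$ let $\ell_w(x)$ be the least preferred edge (under $>_w$) of $\mathrm{supp}(x_w)$. The most preferred edge (if any) among the edges $e=wf\in E_w$ with $e\le_w\ell_w(x)$ and $e$ interesting for $f$ under $x$ is called $W$-admissible and denoted $a_w(x)$ (there is none if $x_w=0$).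 For a $W$-admissible $a=wf$, $C_f(x_f+\mathbf 1^a)$ equals $x_f+\mathbf 1^a$ or $x_f+\mathbf 1^a-\mathbf 1^c$ for some $c\in E_f\setminus\{a\}$; in the latter case $c$ is called $F$-admissible, associated with $a$, and $(a,c)$ is a tandem for $x$ passing $f$. $D(x)$ is the directed graph on $V$ whose edges are the $W$-admissible edges directed from $W$ to $F$ and the $F$-admissible edges directed from $F$ to $W$. Cleaning: while some $w\in W$ has a leaving edge $a=(w,f)$ but no entering edge, delete $a$, and also delete the edge $c$ associated with $a$ (if exists) when $c$ is in no other tandem passing $f$ in the current graph; remove isolated vertices. The final graph is the active graph $\Gamma(x)$. In it each vertex of $W$ has exactly one entering and one leaving edge, and at each vertex $f\in F$ the tandems passing $f$ are edge-disjoint and partition the edges of $\Gamma(x)$ at $f$. Hence $\Gamma(x)$ decomposes uniquely into edge-disjoint directed edge-simple cycles in which consecutive edges at each $f\in F$ form a tandem; these cycles are the rotations generated by (applicable to) $x$, and $\mathcal L(x)$ is their set. For a rotation $L$, $L^+$ (resp. $L^-$) is the set of its edges directed from $W$ to $F$ (resp. from $F$ to $W$), identified with the underlying edges of $G$. $\chi^A\in\mathbb R^E$ is the 0/1 incidence vector of $A\subseteq E$. *)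

(* Defs.v *)
From mathcomp Require Import all_boot.

Set Implicit Arguments.
Unset Strict Implicit.
Unset Printing Implicit Defensive.

(* Since [edge] is a type with two endpoint maps, [simple_graph] is the
   absence of multiple edges; bipartiteness is built into the endpoints. *)
Record bigraph := Bigraph {
  worker : finType;
  firm : finType;
  edge : finType;
  wend : edge -> worker;
  fend : edge -> firm;
  simple_graph : injective (fun e => (wend e, fend e));
  connected_graph : forall u v : worker + firm,
    connect (fun u v => [exists e,
      ((u == inl (wend e)) && (v == inr (fend e))) ||
      ((u == inr (fend e)) && (v == inl (wend e)))]) u v }.

Definition vertex (G : bigraph) : finType := (worker G + firm G)%type.

Definition incident (G : bigraph) (v : vertex G) (e : edge G) : bool :=
  match v with inl w => wend e == w | inr f => fend e == f end.

(* A vector indexed by E_v is represented by its extension by 0 to E. *)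
Definition vec (G : bigraph) := {ffun edge G -> nat}.

Definition restr (G : bigraph) (v : vertex G) (x : vec G) : vec G :=
  [ffun e => if incident v e then x e else 0].

Definition vle (G : bigraph) (z z' : vec G) : bool := [forall e, z e <= z' e].
Definition vmin (G : bigraph) (z z' : vec G) : vec G :=
  [ffun e => minn (z e) (z' e)].
Definition vmax (G : bigraph) (z z' : vec G) : vec G :=
  [ffun e => maxn (z e) (z' e)].
Definition vsize (G : bigraph) (z : vec G) : nat := \sum_e z e.
Definition add_unit (G : bigraph) (z : vec G) (a : edge G) : vec G :=
  [ffun e => z e + (e == a)].
Definition set_coord (G : bigraph) (z : vec G) (a : edge G) (n : nat) : vec G :=
  [ffun e => if e == a then n else z e].

Definition in_B (G : bigraph) (b : vec G) (v : vertex G) (z : vec G) : bool :=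
  vle z b && (restr v z == z).

(* [choiceF f] is only constrained, and only ever used, on B_f. *)
Record market := Market {
  graph :> bigraph;
  cap : vec graph;
  quota : worker graph -> nat;
  wpref : worker graph -> rel (edge graph);
  wpref_irr : forall w e, wend e = w -> ~~ wpref w e e;
  wpref_trans : forall w e1 e2 e3,
    wend e1 = w -> wend e2 = w -> wend e3 = w ->
    wpref w e1 e2 -> wpref w e2 e3 -> wpref w e1 e3;
  wpref_total : forall w e1 e2, wend e1 = w -> wend e2 = w ->
    e1 != e2 -> wpref w e1 e2 || wpref w e2 e1;
  choiceF : firm graph -> vec graph -> vec graph;
  choiceF_le : forall f z, in_B cap (inr f) z -> vle (choiceF f z) z;
  choiceF_A1 : forall f z z', in_B cap (inr f) z -> in_B cap (inr f) z' ->
    vle z' z -> vle (choiceF f z) z' -> choiceF f z' = choiceF f z;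
  choiceF_A2 : forall f z z', in_B cap (inr f) z -> in_B cap (inr f) z' ->
    vle z' z -> vle (vmin (choiceF f z) z') (choiceF f z');
  choiceF_A3 : forall f z z', in_B cap (inr f) z -> in_B cap (inr f) z' ->
    vle z' z -> vsize (choiceF f z') <= vsize (choiceF f z) }.

(* Weak preference: [wprefeq w e e'] is e >=_w e'. *)
Definition wprefeq (M : market) (w : worker M) (e e' : edge M) : bool :=
  (e == e') || wpref w e e'.

(* E_w listed from most to least preferred. *)
Definition wlist (M : market) (w : worker M) : seq (edge M) :=
  sort (wprefeq w) (enum [pred e | wend e == w]).

(* Positions are counted from 0, so e_1, ..., e_j are those of index < j and
   e_(j+1) is the one of index j. *)
Definition choiceW (M : market) (w : worker M) (z : vec M) : vec M :=
  if vsize z <= quota w then z else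
  let s := wlist w in
  let j := \max_(k < (size s).+1 | \sum_(e <- take k s) z e <= quota w) k in
  let r := \sum_(e <- take j s) z e in
  [ffun e => if index e s < j then z e
             else if index e s == j then quota w - r else 0].

Definition choice (M : market) (v : vertex M) (z : vec M) : vec M :=
  match v with inl w => choiceW w z | inr f => choiceF f z end.

Definition acceptable (M : market) (v : vertex M) (z : vec M) : bool :=
  in_B (cap M) v z && (choice v z == z).

(* [prec v z' z] is z' <_v z, a relation on acceptable vectors. *)
Definition prec (M : market) (v : vertex M) (z' z : vec M) : bool :=
  [&& acceptable v z', acceptable v z, z' != z & choice v (vmax z z') == z].
Definition preceq (M : market) (v : vertex M) (z' z : vec M) : bool :=
  (z' == z) || prec v z' z.

Definition g_alloc (M : market) (x : vec M) : bool :=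
  vle x (cap M) && [forall v : vertex M, acceptable v (restr v x)].

Definition precF (M : market) (x y : vec M) : bool :=
  [&& g_alloc x, g_alloc y, x != y &
      [forall f : firm M, preceq (inr f) (restr (inr f) x) (restr (inr f) y)]].
Definition preceqF (M : market) (x y : vec M) : bool := (x == y) || precF x y.

(* The vector z' of the definition is determined by its value n at e; see
   [interestingP] for the unfolded form. *)
Definition interesting (M : market) (v : vertex M) (z : vec M) (e : edge M) :
    bool :=
  incident v e &&
  [exists n : 'I_(cap M e).+1,
     (z e < n) && (z e < choice v (set_coord z e n) e)].

Lemma interestingP (M : market) (v : vertex M) (z : vec M) (e : edge M) :
  in_B (cap M) v z ->
  reflect (incident v e /\ exists z' : vec M,
             [/\ in_B (cap M) v z', z e < z' e,
                 forall e', e' != e -> z' e' = z e' & z e < choice v z' e])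
          (interesting v z e).
Proof.
move=> /andP[/forallP zb /eqP zv].
apply: (iffP andP) => [[ve /existsP[n /andP[zn zC]]]|[ve [z' [Bz' zz' z'z zC]]]];
  split=> //.
  exists (set_coord z e n); split=> //; last 2 first.
  - by rewrite ffunE eqxx.
  - by move=> e' /negPf ne; rewrite ffunE ne.
  apply/andP; split.
    apply/forallP=> e'; rewrite ffunE; case: eqP => [->|_]; last exact: zb.
    by rewrite -ltnS ltn_ord.
  apply/eqP/ffunP=> e'; rewrite !ffunE; case: eqP => [->|_]; first by rewrite ve.
  by rewrite -[in RHS]zv ffunE.
have z'b : z' e < (cap M e).+1 by case/andP: Bz' => /forallP/(_ e).
apply/existsP; exists (Ordinal z'b) => /=; rewrite zz' /=.
suff <- : z' = set_coord z e (z' e) by [].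
apply/ffunP=> e'; rewrite ffunE; case: eqP => [->//|/eqP]; exact: z'z.
Qed.

Definition interesting_under (M : market) (v : vertex M) (x : vec M)
  (e : edge M) : bool := interesting v (restr v x) e.

Definition blocks (M : market) (x : vec M) (e : edge M) : bool :=
  interesting_under (inl (wend e)) x e && interesting_under (inr (fend e)) x e.

Definition stable (M : market) (x : vec M) : bool :=
  g_alloc x && [forall e, ~~ blocks x e].

(* w belongs to W^= *)
Definition saturated (M : market) (x : vec M) (w : worker M) : bool :=
  vsize (restr (inl w) x) == quota w.

(* l = l_w(x) *)
Definition least_used (M : market) (x : vec M) (w : worker M) (l : edge M) :
    bool :=
  [&& wend l == w, x l != 0 &
      [forall e, (wend e == w) && (x e != 0) ==> wprefeq w e l]].

Definition W_candidate (M : market) (x : vec M) (w : worker M) (a : edge M) :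
    bool :=
  [&& wend a == w, saturated x w,
      [exists l, least_used x w l && wprefeq w l a] &
      interesting_under (inr (fend a)) x a].

(* a = a_w(x) for its worker endpoint w *)
Definition W_admissible (M : market) (x : vec M) (a : edge M) : bool :=
  W_candidate x (wend a) a &&
  [forall e, W_candidate x (wend a) e ==> wprefeq (wend a) a e].

(* The equation C_f(x_f + 1^a) = x_f + 1^a - 1^c is written with 1^c moved to
   the left, so as not to involve the truncated subtraction of nat. *)
Definition tandem (M : market) (x : vec M) (a c : edge M) : bool :=
  let f := fend a in
  let z := add_unit (restr (inr f) x) a in
  [&& W_admissible x a, fend c == f, c != a &
      add_unit (choiceF f z) c == z].

Definition F_admissible (M : market) (x : vec M) (c : edge M) : bool :=
  [exists a, tandem x a c].

(* [inl e] is the edge e directed from W to F, [inr e] the same edge directed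
   from F to W. A directed graph is given by its arcs, its vertices being the
   endpoints of the arcs, so that there are no isolated vertices. *)
Definition arc (G : bigraph) : finType := (edge G + edge G)%type.

Definition arc_src (G : bigraph) (d : arc G) : vertex G :=
  match d with inl e => inl (wend e) | inr e => inr (fend e) end.
Definition arc_tgt (G : bigraph) (d : arc G) : vertex G :=
  match d with inl e => inr (fend e) | inr e => inl (wend e) end.

Definition digraph_D (M : market) (x : vec M) : {set arc M} :=
  [set d | match d with inl a => W_admissible x a | inr c => F_admissible x c end].

(* The arc a leaves a worker that no arc of D enters. *)
Definition removable (M : market) (D : {set arc M}) (a : edge M) : bool :=
  (inl a \in D) && [forall d in D, arc_tgt d != inl (wend a)].

Definition delete_arcs (M : market) (x : vec M) (D : {set arc M})
    (a : edge M) : {set arc M} :=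
  D :\: [set d | match d with
    | inl e => e == a
    | inr c => tandem x a c &&
        [forall a', (a' != a) && (inl a' \in D) ==> ~~ tandem x a' c]
    end].

Definition clean_step (M : market) (x : vec M) (D : {set arc M}) :
    {set arc M} :=
  if [pick a | removable D a] is Some a then delete_arcs x D a else D.

(* Each effective step deletes an arc [inl a], so #|edge M| steps exhaust the
   cleaning loop; see [active_graph_clean]. The order of deletions is
   irrelevant to the final graph. *)
Definition active_graph (M : market) (x : vec M) : {set arc M} :=
  iter #|edge M| (clean_step x) (digraph_D x).

Lemma active_graph_clean (M : market) (x : vec M) (a : edge M) :
  ~~ removable (active_graph x) a.
Proof.
pose m (D : {set arc M}) := #|[set e : edge M | inl e \in D]|.
have stop D : m D = 0 -> forall a, ~~ removable D a.
  move=> /cards0_eq D0 e; rewrite /removable.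
  by have := in_set0 e; rewrite -D0 inE => ->.
have step D n : m D <= n.+1 ->
    m (clean_step x D) <= n \/ forall a, ~~ removable D a.
  move=> mD; rewrite /clean_step; case: pickP => [e re|nr]; last first.
    by right=> e; rewrite nr.
  left; rewrite -ltnS; apply: leq_trans mD; apply: proper_card.
  apply/properP; split.
    by apply/subsetP=> e'; rewrite !inE => /andP[].
  by exists e; rewrite !inE ?eqxx //; case/andP: re.
have fixed D n : (forall a, ~~ removable D a) -> iter n (clean_step x) D = D.
  move=> nr; elim: n => //= n ->; rewrite /clean_step.
  by case: pickP => // e; rewrite (negPf (nr e)).
rewrite /active_graph; move: (digraph_D x) (max_card [set e | inl e \in digraph_D x]).
move=> D; rewrite -/(m D); move: #|_| => n; elim: n D => [|n IHn] D mD.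
  by apply: stop; apply/eqP; rewrite -leqn0.
have [mD'|nr] := step D n mD; first by rewrite iterSr; apply: IHn.
by rewrite fixed.
Qed.

(* When the target of d is a firm, d enters it and d' leaves it, hence d and d'
   are of the form [inl a] and [inr c]. *)
Definition consecutive (M : market) (x : vec M) (d d' : arc M) : bool :=
  (arc_tgt d == arc_src d') &&
  match d, d' with inl a, inr c => tandem x a c | _, _ => true end.

(* A rotation generated by x, as the cyclic sequence of its arcs. *)
Definition rotation (M : market) (x : vec M) (L : seq (arc M)) : bool :=
  [&& L != [::], all [in active_graph x] L, uniq L & cycle (consecutive x) L].

(* [shifted x x'] is x' \in S_x; again the subtracted term of
   x' = x + chi^(L^+) - chi^(L^-) is moved to the left. *)
Definition shifted (M : market) (x x' : vec M) : Prop :=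
  exists2 L : seq (arc M), rotation x L &
    forall e, x' e + (inr e \in L) = x e + (inl e \in L).

(* Main.v *)
Require Import Defs.
From mathcomp Require Import all_boot.

Set Implicit Arguments.
Unset Strict Implicit.
Unset Printing Implicit Defensive.

(** Going up from [x] towards [y], every worker whose assignment changes loses
    some edges and gains others. A gained edge is interesting for its firm, by
    (A2), so stability of [x] makes it uninteresting for its worker: the worker
    is saturated and ranks the edge no higher than the least one used
    ([gain_worker]). Counting both ways, through workers and through firms,
    then shows that [x] and [y] have the same size at every vertex
    ([worker_size_eq], [firm_size_eq]), so that a worker losing on one edge
    gains on another ([loss_gains]).

    A gaining worker [w] thus has a W-admissible edge [a = a_w(x)], at least as
    good for [w] as all its gains. Let [f] be the firm of [a]. If [y] does not
    increase [a], then [w] is interested in [a] under [y], and stability of [y]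
    makes [f] refuse one more unit of it ([admissible_refused]). Either way,
    proposals along such edges cannot draw [f] away from [y]: the choice from
    the join of [y] with [x] augmented by the proposals is still [y]
    ([choiceF_proposed_y]). As [x] and [y] have the same size at [f], (A3)
    forces [f] to drop a unit of some edge [c] when it is offered [a], and (A2)
    shows that [y c < x c]. Hence the worker of [c] is again a gaining one
    ([gains_tandem]).

    The gaining workers are therefore closed under following tandems, so these
    close up into a cycle visiting each worker at most once. Its arcs survive
    the cleaning, since each worker on it has an entering arc; it is a rotation
    ([alternation_rotation]). For the shifted vector [x'], (A2) and a count of
    sizes identify [x'] at [f] with the choice of [f] from [x] augmented by all
    the proposals made to [f]; consistency (A1) then gives both acceptability
    of [x'] and the comparison with [y] ([shift_firm]). At workers only the
    total matters, and the shift preserves it. *)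

(** * Finite sums and cycles of functions *)

Lemma sum_eq_pointwise (I : finType) (g h : I -> nat) :
  (forall i, g i <= h i) -> \sum_i h i <= \sum_i g i -> g =1 h.
Proof.
move=> gh hg i.
have ghE j : true -> g j <= h j ?= iff (g j == h j) by split.
have [le_s eq_s] := leqif_sum ghE.
by apply/eqP; move: i; apply/forallP; rewrite -eq_s eqn_leq le_s.
Qed.

(** The orbit of the starting point eventually loops; the loop is the cycle. *)
Lemma exists_fcycle (T : finType) (g : T -> T) (P : pred T) (t0 : T) :
  P t0 -> (forall t, P t -> P (g t)) ->
  exists s, [/\ s != [::], uniq s, fcycle g s & all P s].
Proof.
move=> Pt0 Pg; have Piter n : P (iter n g t0) by elim: n => //= n; apply: Pg.
have /trajectP[i lt_in eq_in] := looping_order g t0.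
set n := order g t0 in lt_in eq_in; set t := iter i g t0 in eq_in.
have [m def_n] : exists m, n = i + m.+1.
  by exists (n - i).-1; rewrite prednK ?subn_gt0 // subnKC // ltnW.
exists (traject g t m.+1); split=> //.
- by have := orbit_uniq g t0; rewrite /orbit -/n def_n trajectD cat_uniq => /and3P[].
- rewrite /=; have -> : rcons (traject g (g t) m) t = traject g (g t) m.+1.
    rewrite trajectSr -iterSr; congr rcons.
    by rewrite -{1}eq_in def_n addnC iterD.
  exact: fpath_traject.
- by apply/allP=> t' /trajectP[j _ ->]; rewrite /t -iterD.
Qed.

(** A function acts on a cycle of its graph by rotating it. *)
Lemma perm_map_fcycle (T : eqType) (g : T -> T) (s : seq T) :
  fcycle g s -> perm_eq (map g s) s.
Proof.
case: s => //= t s; rewrite -[g t :: _]/(map g (t :: s)).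
have map_belast t' s' : fpath g t' s' -> s' = map g (belast t' s').
  by elim: s' t' => //= t1 s' IH t' /andP[/eqP<- /IH {1}->].
by move=> /map_belast; rewrite belast_rcons => <-; rewrite perm_rcons.
Qed.

Lemma sum_mem_uniq (I : finType) (P : pred I) (s : seq I) : uniq s ->
  \sum_(i | P i) (i \in s) = count P s.
Proof.
move=> us; rewrite -sum1_count [RHS]big_mkcond big_uniq //=.
rewrite big_mkcond [RHS]big_mkcond; apply: eq_bigr => i _.
by case: (P i); case: (i \in s).
Qed.

(** * Vectors on the edges at a vertex *)

Section Vectors.

Variable M : market.
Implicit Types (v : vertex M) (f : firm M) (w : worker M) (x y z u : vec M).
Implicit Types e a : edge M.

Lemma vleP z z' : reflect (forall e, z e <= z' e) (vle z z').
Proof. exact: forallP. Qed.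

Lemma restrE v x e : incident v e -> restr v x e = x e.
Proof. by rewrite ffunE => ->. Qed.

Lemma restrF v x e : ~~ incident v e -> restr v x e = 0.
Proof. by rewrite ffunE => /negPf->. Qed.

Lemma in_BP v z :
  reflect ((forall e, z e <= cap M e) /\ (forall e, ~~ incident v e -> z e = 0))
          (in_B (cap M) v z).
Proof.
apply: (iffP andP) => [[/vleP zb /eqP zv]|[zb z0]].
  split=> e; last by rewrite -zv; apply: restrF.
  exact: zb.
split; first exact/vleP.
by apply/eqP/ffunP=> e; rewrite ffunE; case: ifPn => // /z0->.
Qed.

Lemma in_B_out v z e : in_B (cap M) v z -> ~~ incident v e -> z e = 0.
Proof. by case/in_BP=> _; apply. Qed.

Lemma in_B_le v z z' : in_B (cap M) v z -> vle z' z -> in_B (cap M) v z'.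
Proof.
move=> /in_BP[zb z0] /vleP z'z; apply/in_BP; split=> [e|e ve].
  exact: leq_trans (z'z e) (zb e).
by apply/eqP; rewrite -leqn0 -(z0 _ ve).
Qed.

Lemma in_B_restr v x : vle x (cap M) -> in_B (cap M) v (restr v x).
Proof.
move=> /vleP xb; apply/in_BP; split=> [e|e ve]; last exact: restrF.
by rewrite ffunE; case: ifP.
Qed.

Lemma in_B_vmax v z z' :
  in_B (cap M) v z -> in_B (cap M) v z' -> in_B (cap M) v (vmax z z').
Proof.
move=> /in_BP[zb z0] /in_BP[z'b z'0]; apply/in_BP; split=> [e|e ve].
  by rewrite ffunE geq_max zb z'b.
by rewrite ffunE z0 ?z'0.
Qed.

Lemma add_unitE z a e : add_unit z a e = z e + (e == a).
Proof. exact: ffunE. Qed.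

Lemma vmaxE z z' e : vmax z z' e = maxn (z e) (z' e).
Proof. exact: ffunE. Qed.

Lemma add_unit_same z a : add_unit z a a = (z a).+1.
Proof. by rewrite ffunE eqxx addn1. Qed.

Lemma vmaxl z z' : vle z (vmax z z').
Proof. by apply/vleP=> e; rewrite ffunE leq_maxl. Qed.

Lemma vmaxr z z' : vle z' (vmax z z').
Proof. by apply/vleP=> e; rewrite ffunE leq_maxr. Qed.

Lemma vsize_restr v x : vsize (restr v x) = \sum_(e | incident v e) x e.
Proof.
by rewrite /vsize [RHS]big_mkcond; apply: eq_bigr => e _; rewrite ffunE.
Qed.

Lemma leq_vsize z z' : vle z z' -> vsize z <= vsize z'.
Proof. by move=> /vleP le_zz'; apply: leq_sum => e _. Qed.

Lemma vle_vsize_eq z z' : vle z z' -> vsize z' <= vsize z -> z = z'.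
Proof. by move=> /vleP zz' sz; apply/ffunP; apply: sum_eq_pointwise. Qed.

Lemma in_B_add_unit f z a : in_B (cap M) (inr f) z -> fend a = f ->
  z a < cap M a -> in_B (cap M) (inr f) (add_unit z a).
Proof.
move=> /in_BP[zb z0] fa za; apply/in_BP; split=> e; rewrite ffunE.
  by case: eqP => [->|_]; rewrite ?addn1 ?addn0.
by move=> ve; rewrite z0 //; case: eqP ve => //= ->; rewrite fa eqxx.
Qed.

(** * Workers' choice functions *)

Lemma mem_wlist w e : (e \in wlist w) = (wend e == w).
Proof. by rewrite /wlist mem_sort mem_enum. Qed.

Lemma wlist_uniq w : uniq (wlist w).
Proof. by rewrite /wlist sort_uniq enum_uniq. Qed.

Lemma wlist_sorted w : sorted (wprefeq w) (wlist w).
Proof.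
apply: (@sort_sorted_in _ [pred e | wend e == w]).
  move=> e e' /eqP we /eqP we'; rewrite /wprefeq.
  case: eqP => // /eqP ne; rewrite eq_sym (negPf ne) /=.
  exact: wpref_total.
by apply/allP=> e; rewrite mem_enum.
Qed.

(** The preference of a worker is read off positions in its sorted list, so that
    best and worst edges are obtained by minimizing and maximizing a number. *)
Lemma wprefeq_index w e e' : wend e = w -> wend e' = w ->
  wprefeq w e e' = (index e (wlist w) <= index e' (wlist w)).
Proof.
have index_pref (a a' : edge M) : wend a = w -> wend a' = w ->
    index a (wlist w) <= index a' (wlist w) -> wprefeq w a a'.
  move=> wa wa'; apply: sorted_leq_index_in; rewrite ?mem_wlist ?wa ?wa' //.
  - move=> a2 a1 a3; rewrite !mem_wlist => /eqP w2 /eqP w1 /eqP w3.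
    rewrite /wprefeq; case: (a1 =P a2) => [->//|_] /= p12.
    case: (a2 =P a3) => [<-|_] /= p23; first by rewrite p12 orbT.
    by rewrite (wpref_trans w1 w2 w3 p12 p23) orbT.
  - by move=> a1 _; rewrite /wprefeq eqxx.
  - exact: wlist_sorted.
move=> we we'; apply/idP/idP; last exact: index_pref.
rewrite leqNgt; apply: contraTN => lt_e'e.
have := index_pref _ _ we' we (ltnW lt_e'e); rewrite /wprefeq.
case: (e' =P e) => [eq_e|_ /=]; first by rewrite eq_e ltnn in lt_e'e.
case: (e =P e') => [eq_e|_ /= p'p]; first by rewrite eq_e ltnn in lt_e'e.
by apply/negP=> pp'; have := wpref_irr we; rewrite (wpref_trans we we' we pp' p'p).
Qed.

Lemma vsize_wlist w z : restr (inl w) z = z ->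
  vsize z = \sum_(e <- wlist w) z e.
Proof.
move=> zw; rewrite -{1}zw vsize_restr big_uniq ?wlist_uniq //=.
by apply: eq_bigl => e; rewrite mem_wlist.
Qed.

(** The cutoff of an oversized vector: the choice is determined by the longest
    prefix of the preference list that fits in the quota. *)
Lemma choiceW_cutoff w z : restr (inl w) z = z -> quota w < vsize z ->
  exists j : nat,
  [/\ j < size (wlist w), \sum_(e <- take j (wlist w)) z e <= quota w,
      forall k, k <= size (wlist w) ->
        \sum_(e <- take k (wlist w)) z e <= quota w -> k <= j &
      choiceW w z = [ffun e => if index e (wlist w) < j then z e
             else if index e (wlist w) == j
             then quota w - \sum_(e <- take j (wlist w)) z e else 0]].
Proof.
move=> zw big_z; rewrite /choiceW leqNgt big_z /=; set s := wlist w.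
pose P (k : 'I_(size s).+1) := \sum_(e <- take k s) z e <= quota w.
have P0 : P ord0 by rewrite /P take0 big_nil.
rewrite -/(P _) (bigmax_eq_arg _ P0); case: arg_maxnP => // j Pj max_j.
exists j; split=> //.
- rewrite ltn_neqAle -ltnS ltn_ord andbT; apply: contraTneq Pj => js.
  by rewrite /P js take_size -ltnNge -vsize_wlist.
- move=> k ks sum_k; have ks1 : k < (size s).+1 by [].
  exact: (max_j (Ordinal ks1)).
Qed.

(** Of an oversized vector the choice keeps exactly the quota: the prefix before
    the cutoff, the rest of the quota at the cutoff, and nothing after it. *)
Lemma choiceW_fix_quota w z : restr (inl w) z = z -> choiceW w z = z ->
  vsize z <= quota w.
Proof.
move=> zw Cz; rewrite leqNgt; apply/negP=> big_z.
have [j [js sum_j _ Cj]] := choiceW_cutoff zw big_z.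
move: Cz; rewrite {}Cj; set s := wlist w in js sum_j * => /ffunP Cz.
have e0 : edge M by case: (s) js.
suff : vsize z = quota w by move: big_z => /[swap] ->; rewrite ltnn.
rewrite (vsize_wlist zw) -/s -(cat_take_drop j s) big_cat /= (drop_nth e0 js) big_cons.
have su : uniq s := wlist_uniq w.
rewrite -(Cz (nth e0 s j)) ffunE index_uniq // ltnn eqxx.
rewrite [X in _ + (_ + X)]big1_seq ?addn0 ?subnKC // => e /= ed.
rewrite -(Cz e) ffunE.
have : j.+1 <= index e s.
  rewrite leqNgt -in_take ?(mem_drop ed) //; apply/negP=> et.
  have := su; rewrite -(cat_take_drop j.+1 s) cat_uniq => /and3P[_ /hasPn/(_ e ed)].
  by rewrite /= et.
by rewrite ltnNge => /negPf lt_j; case: ltngtP lt_j => // /ltnW ->.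
Qed.

Lemma set_coordS z e : set_coord z e (z e).+1 = add_unit z e.
Proof.
apply/ffunP=> e'; rewrite !ffunE; case: eqP => [->|_]; first by rewrite addn1.
by rewrite addn0.
Qed.

Lemma vsize_add_unit z e : vsize (add_unit z e) = (vsize z).+1.
Proof.
rewrite /vsize (eq_bigr (fun e' => z e' + (e' == e))) => [|e' _]; last by rewrite ffunE.
rewrite big_split /= -addn1; congr (_ + _).
rewrite (bigD1 e) //= eqxx big1 // => e' ne.
by rewrite (negPf ne).
Qed.

Lemma interesting_add_unit v z e : incident v e -> z e < cap M e ->
  z e < choice v (add_unit z e) e -> interesting v z e.
Proof.
move=> ve ze zC; rewrite /interesting ve /=; apply/existsP.
have ze1 : (z e).+1 < (cap M e).+1 by [].
by exists (Ordinal ze1); rewrite /= ltnSn /= set_coordS.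
Qed.

Lemma choiceW_underfull w z e : vsize z < quota w ->
  choiceW w (add_unit z e) = add_unit z e.
Proof. by move=> zq; rewrite /choiceW vsize_add_unit zq. Qed.

(** When [e] precedes a used edge [l], the prefix of the list ending in [e] still
    fits in the quota after the increase of [e], since it leaves out [l]. *)
Lemma choiceW_preferred w z e l : restr (inl w) z = z -> vsize z <= quota w ->
  wend e = w -> wend l = w -> 0 < z l -> ~~ wprefeq w l e ->
  choiceW w (add_unit z e) e = (z e).+1.
Proof.
move=> zw zq we wl zl; rewrite wprefeq_index // -ltnNge => lt_el.
have z1e : add_unit z e e = (z e).+1 by rewrite ffunE eqxx addn1.
have [small|big] := leqP (vsize (add_unit z e)) (quota w).
  by rewrite /choiceW small.
have z1w : restr (inl w) (add_unit z e) = add_unit z e.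
  apply/ffunP=> e'; rewrite ffunE; case: ifPn => // we'.
  rewrite ffunE -zw restrF //; case: eqP we' => //= ->.
  by rewrite we eqxx.
have [j [js _ max_j ->]] := choiceW_cutoff z1w big.
rewrite ffunE z1e; set s := wlist w in js max_j lt_el *.
suff -> : index e s < j by [].
apply: max_j; first by apply: leq_trans lt_el (index_size _ _).
have ls : l \in s by rewrite mem_wlist wl.
have ne_l : l != e by apply: contraTneq lt_el => ->; rewrite ltnn.
have ld : l \in drop (index e s).+1 s.
  have : l \in take (index e s).+1 s ++ drop (index e s).+1 s by rewrite cat_take_drop.
  by rewrite mem_cat in_take // ltnS leqNgt lt_el.
rewrite -ltnS; apply: leq_ltn_trans (_ : quota w < (quota w).+1) => //.
have := vsize_wlist z1w; rewrite -/s -{1}(cat_take_drop (index e s).+1 s) big_cat /=.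
rewrite (big_rem _ ld) /= vsize_add_unit [add_unit z e l]ffunE (negPf ne_l) addn0.
move=> sumE; rewrite -ltnS; apply: leq_trans (_ : (vsize z).+1 <= _) => //.
rewrite sumE -addn1 leq_add2l; exact: leq_trans zl (leq_addr _ _).
Qed.

(** * Firms' choice functions *)

(** The pointwise form of (A2): what is kept from a larger vector is kept from a
    smaller one, as far as it is still offered. *)
Lemma choiceF_min f u z e : in_B (cap M) (inr f) u -> vle z u ->
  minn (choiceF f u e) (z e) <= choiceF f z e.
Proof.
move=> Bu zu; have /vleP/(_ e) := choiceF_A2 Bu (in_B_le Bu zu) zu.
by rewrite ffunE.
Qed.

Lemma choiceF_between f u z : in_B (cap M) (inr f) u -> vle z u ->
  vle (choiceF f u) z -> choiceF f z = choiceF f u.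
Proof. by move=> Bu zu; apply: choiceF_A1 (in_B_le Bu zu) zu. Qed.

Lemma choiceF_size f u z : in_B (cap M) (inr f) u -> vle z u ->
  vsize (choiceF f z) <= vsize (choiceF f u).
Proof. by move=> Bu zu; apply: choiceF_A3 (in_B_le Bu zu) zu. Qed.

Lemma choiceF_leE f z e : in_B (cap M) (inr f) z -> choiceF f z e <= z e.
Proof. by move=> Bz; have /vleP := choiceF_le Bz. Qed.

(** By (A2), an interesting edge is already accepted when raised by one unit, so
    it is enough to work with unit increments. *)
Lemma interesting_firm f z a : in_B (cap M) (inr f) z ->
  interesting (inr f) z a ->
  [/\ fend a = f, z a < cap M a & choiceF f (add_unit z a) a = (z a).+1].
Proof.
move=> Bz /(interestingP _ Bz)[/= /eqP fa [z' [Bz' zz' z'z zC]]].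
have za : z a < cap M a by case/in_BP: Bz' => /(_ a)/(leq_trans zz').
have Bz1 := in_B_add_unit Bz fa za.
have z1z' : vle (add_unit z a) z'.
  apply/vleP=> e; rewrite ffunE; case: eqP => [->|/eqP/z'z->]; last by rewrite addn0.
  by rewrite addn1.
split=> //; apply/eqP; rewrite eqn_leq.
have := choiceF_leE a Bz1; have := choiceF_min a Bz' z1z'.
rewrite ffunE eqxx addn1 => + ->; apply: leq_trans.
by rewrite leq_min zC ltnSn.
Qed.

Lemma acceptable_restr v x : g_alloc x -> acceptable v (restr v x).
Proof. by case/andP=> _ /forallP. Qed.

Lemma g_alloc_in_B v x : g_alloc x -> in_B (cap M) v (restr v x).
Proof. by move/(acceptable_restr v)/andP=> []. Qed.

Lemma preceq_choiceF f z z' : acceptable (inr f) z -> preceq (inr f) z' z ->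
  choiceF f (vmax z z') = z.
Proof.
move=> /andP[_ /eqP Cz] /orP[/eqP->|/and4P[_ _ _ /eqP //]].
by rewrite -{3}Cz; congr choiceF; apply/ffunP=> e; rewrite ffunE maxnn.
Qed.
End Vectors.

(** * Gains and losses between two stable allocations *)

Section Comparison.

Variables (M : market) (x y : vec M).
Hypotheses (hx : stable x) (hy : stable y) (hxy : precF x y).
Implicit Types (f : firm M) (w : worker M) (e a c l : edge M).

Lemma stable_g_alloc z : stable z -> @g_alloc M z.
Proof. by case/andP. Qed.

Let gx := stable_g_alloc hx.
Let gy := stable_g_alloc hy.

Lemma g_alloc_cap z e : @g_alloc M z -> z e <= cap M e.
Proof. by case/andP=> /vleP. Qed.

Lemma g_alloc_quota z w : @g_alloc M z -> vsize (restr (inl w) z) <= quota w.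
Proof.
move=> gz; have /andP[/andP[_ /eqP zw] /eqP Cz] := acceptable_restr (inl w) gz.
exact: choiceW_fix_quota.
Qed.

Lemma stable_worker_refuses z e :
  @stable M z -> z e < cap M e -> interesting_under (inr (fend e)) z e ->
  saturated z (wend e) /\
  (forall l, wend l = wend e -> 0 < z l -> wprefeq (wend e) l e).
Proof.
move=> sz ze firm_e; have gz := stable_g_alloc sz.
have : ~~ interesting_under (inl (wend e)) z e.
  by case/andP: sz => _ /forallP/(_ e); rewrite /blocks firm_e andbT.
set w := wend e; set zw := restr (inl w) z.
have zwE e' : wend e' = w -> zw e' = z e' by move=> we'; rewrite restrE //= we'.
have worker_e : zw e < choiceW w (add_unit zw e) e ->
    interesting_under (inl w) z e.
  by move=> Ce; apply: interesting_add_unit; rewrite //= ?eqxx ?[restr _ _ _]zwE.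
have /andP[/andP[_ /eqP zww] _] := acceptable_restr (inl w) gz.
move=> /negP not_e; split.
  rewrite /saturated eqn_leq g_alloc_quota //= leqNgt; apply/negP=> under.
  by apply/not_e/worker_e; rewrite choiceW_underfull // add_unit_same.
move=> l wl zl; apply/negPn/negP=> nle; apply/not_e/worker_e.
by rewrite (choiceW_preferred zww _ _ wl) ?g_alloc_quota // zwE.
Qed.

Lemma precF_choiceF f :
  choiceF f (vmax (restr (inr f) y) (restr (inr f) x)) = restr (inr f) y.
Proof.
apply: preceq_choiceF; first exact: acceptable_restr.
by case/and4P: hxy => _ _ _ /forallP.
Qed.

(** The firm takes [y e > x e] from the join of [x] and [y], hence by (A2) takes
    [x e + 1] when only [e] is raised above [x]. *)
Lemma gain_interesting e : x e < y e -> interesting_under (inr (fend e)) x e.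
Proof.
move=> xye; set f := fend e.
have Bx := g_alloc_in_B (inr f) gx; have By := g_alloc_in_B (inr f) gy.
have xe : restr (inr f) x e = x e by rewrite restrE //= eqxx.
have ye : restr (inr f) y e = y e by rewrite restrE //= eqxx.
apply: interesting_add_unit; rewrite //= ?eqxx // xe.
  exact: leq_trans xye (g_alloc_cap e gy).
have /(choiceF_min e (in_B_vmax By Bx)) :
    vle (add_unit (restr (inr f) x) e) (vmax (restr (inr f) y) (restr (inr f) x)).
  apply/vleP=> e'; rewrite add_unitE vmaxE; case: (e' =P e) => [->|_].
    by rewrite xe ye addn1 leq_max xye.
  by rewrite addn0 leq_maxr.
by rewrite precF_choiceF ye add_unit_same xe (minn_idPr xye).
Qed.

Lemma gain_worker e : x e < y e ->
  saturated x (wend e) /\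
  (forall l, wend l = wend e -> 0 < x l -> wprefeq (wend e) l e).
Proof.
move=> xye; apply: stable_worker_refuses => //; last exact: gain_interesting.
exact: leq_trans xye (g_alloc_cap e gy).
Qed.

Definition gains w := [exists e, (wend e == w) && (x e < y e)].

Lemma gainsPn w : ~~ gains w -> vle (restr (inl w) y) (restr (inl w) x).
Proof.
move=> /existsPn no_gain; apply/vleP=> e; rewrite !ffunE /=.
by case: ifP => // we; have := no_gain e; rewrite we -leqNgt.
Qed.

(** A worker that gains on some edge is saturated under [x]; one that does not can
    only lose. *)
Lemma worker_size_le w : vsize (restr (inl w) y) <= vsize (restr (inl w) x).
Proof.
have [|/gainsPn] := boolP (gains w); last exact: leq_vsize.
case/existsP=> e /andP[/eqP <- /gain_worker[/eqP-> _]].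
exact: g_alloc_quota.
Qed.

(** At [f], [y] is the choice from a vector above [x], so (A3) applies. *)
Lemma firm_size_le f : vsize (restr (inr f) x) <= vsize (restr (inr f) y).
Proof.
have Bx := g_alloc_in_B (inr f) gx; have By := g_alloc_in_B (inr f) gy.
have /andP[_ /eqP <-] := acceptable_restr (inr f) gx.
rewrite -(precF_choiceF f).
by apply: choiceF_size (vmaxr _ _); apply: in_B_vmax.
Qed.

Lemma sum_worker_sizes (z : vec M) :
  \sum_w vsize (restr (inl w) z) = \sum_e z e.
Proof.
rewrite (partition_big (@wend M) predT) //=.
by apply: eq_bigr => w _; rewrite vsize_restr.
Qed.

Lemma sum_firm_sizes (z : vec M) :
  \sum_f vsize (restr (inr f) z) = \sum_e z e.
Proof.
rewrite (partition_big (@fend M) predT) //=.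
by apply: eq_bigr => f _; rewrite vsize_restr.
Qed.

(** Workers do not grow and firms do not shrink from [x] to [y], while both count
    the same total. *)
Lemma sum_size_eq : \sum_e x e = \sum_e y e.
Proof.
apply/eqP; rewrite eqn_leq -{1}(sum_firm_sizes x) -{1}(sum_firm_sizes y).
rewrite -(sum_worker_sizes x) -(sum_worker_sizes y).
by rewrite !leq_sum // => v _; rewrite ?firm_size_le ?worker_size_le.
Qed.

Lemma worker_size_eq w : vsize (restr (inl w) y) = vsize (restr (inl w) x).
Proof.
move: w; apply: sum_eq_pointwise; first exact: worker_size_le.
by rewrite !sum_worker_sizes sum_size_eq.
Qed.

Lemma firm_size_eq f : vsize (restr (inr f) x) = vsize (restr (inr f) y).
Proof.
move: f; apply: sum_eq_pointwise; first exact: firm_size_le.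
by rewrite !sum_firm_sizes sum_size_eq.
Qed.

Lemma loss_gains e : y e < x e -> gains (wend e).
Proof.
apply: contraLR => /gainsPn le_yx; rewrite -leqNgt.
have /ffunP/(_ e) := vle_vsize_eq le_yx (eq_leq (esym (worker_size_eq _))).
by rewrite !restrE /= ?eqxx // => ->.
Qed.

(** A gained edge lies at or below the least used one; the latter exists because
    the worker has as many units under [x] as under [y], hence at least one. *)
Lemma gain_candidate e : x e < y e -> W_candidate x (wend e) e.
Proof.
move=> xye; have [sat_e pref_e] := gain_worker xye.
rewrite /W_candidate eqxx sat_e gain_interesting //= andbT.
have [l0 wl0 xl0] : exists2 l, wend l == wend e & 0 < x l.
  have : 0 < \sum_(l | wend l == wend e) x l.
    have <- : vsize (restr (inl (wend e)) y) = \sum_(l | wend l == wend e) x l.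
      by rewrite worker_size_eq vsize_restr.
    rewrite vsize_restr (bigD1 e) //= ?eqxx //.
    by apply: leq_trans (leq_addr _ _); apply: leq_trans xye.
  rewrite lt0n sum_nat_eq0 => /forallPn[l]; rewrite negb_imply => /andP[wl xl].
  by exists l; rewrite ?lt0n.
pose P l := (wend l == wend e) && (0 < x l).
have Pl0 : P l0 by rewrite /P wl0.
have [l /andP[/eqP wl xl] max_l] := arg_maxnP (fun l => index l (wlist (wend e))) Pl0.
apply/existsP; exists l; rewrite pref_e // andbT /least_used wl eqxx -lt0n xl /=.
apply/forallP=> l'; apply/implyP=> /andP[/eqP wl' xl'].
by rewrite wprefeq_index //; apply: max_l; rewrite /P wl' eqxx lt0n.
Qed.

Lemma gains_admissible w : gains w -> exists2 a, wend a = w & W_admissible x a.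
Proof.
case/existsP=> e /andP[/eqP we /gain_candidate]; rewrite we => cand_e.
have [a cand_a min_a] := arg_minnP (fun a => index a (wlist w)) cand_e.
have wa : wend a = w by case/and4P: cand_a => /eqP.
exists a => //; rewrite /W_admissible wa cand_a.
apply/forallP=> e'; apply/implyP=> cand_e'.
have we' : wend e' = w by case/and4P: cand_e' => /eqP.
by rewrite wprefeq_index //; apply: min_a.
Qed.

(** * Proposals along admissible edges *)

Lemma W_admissible_firm a (f := fend a) : W_admissible x a ->
  x a < cap M a /\
  choiceF f (add_unit (restr (inr f) x) a) a = (x a).+1.
Proof.
case/andP=> /and4P[_ _ _ int_a] _.
have [_ +] := interesting_firm (g_alloc_in_B (inr f) gx) int_a.
by rewrite restrE //= eqxx.
Qed.

(** The worker of [a] gains on some edge [e], which comes strictly after [a] in its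
    preference and is used by [y]. So it would like more of [a] under [y], and
    stability of [y] leaves the refusal to the firm. *)
Lemma admissible_refused a (f := fend a) :
  W_admissible x a -> gains (wend a) -> y a <= x a ->
  choiceF f (add_unit (restr (inr f) y) a) a <= y a.
Proof.
move=> adm_a /existsP[e /andP[/eqP we xye]] ya.
have [xa _] := W_admissible_firm adm_a.
have ya_cap := leq_ltn_trans ya xa.
have yaE : restr (inr f) y a = y a by rewrite restrE //= eqxx.
rewrite leqNgt; apply/negP=> Ca.
have int_a : interesting_under (inr f) y a.
  by apply: interesting_add_unit; rewrite //= ?eqxx ?yaE.
have [_ /(_ e we)] := stable_worker_refuses hy ya_cap int_a.
rewrite (leq_trans _ xye) // => /(_ isT).
have := gain_candidate xye; rewrite we.
case/andP: adm_a => _ /forallP/(_ e)/implyP/[apply].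
rewrite !wprefeq_index // => le_ae le_ea.
have mem e' : wend e' = wend a -> e' \in wlist (wend a) by rewrite mem_wlist => ->.
(* Were [e] ranked no lower than [a], both would be the best candidate. *)
have eq_ae : a = e.
  apply: (index_inj a (mem a erefl) (mem e we)).
  by apply/eqP; rewrite eqn_leq le_ae le_ea.
by move: xye; rewrite -eq_ae ltnNge ya.
Qed.

(** What [f] holds under [x], together with one more unit of each edge of [A]. *)
Definition proposed f (A : seq (edge M)) : vec M :=
  restr (inr f) [ffun e => x e + (e \in A)].

Lemma proposedE f A e : fend e = f -> proposed f A e = x e + (e \in A).
Proof. by move=> fe; rewrite restrE ?ffunE //= fe. Qed.

Lemma proposed1 f a : fend a = f ->
  proposed f [:: a] = add_unit (restr (inr f) x) a.
Proof.
move=> fa; apply/ffunP=> e; rewrite !ffunE inE /=; case: ifP => //.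
by case: (e =P a) => // ->; rewrite fa eqxx.
Qed.

Lemma restr_proposed f A : vle (restr (inr f) x) (proposed f A).
Proof. by apply/vleP=> e; rewrite !ffunE; case: ifP => // _; apply: leq_addr. Qed.

Section Proposals.

Variables (f : firm M) (A : seq (edge M)).
Hypothesis admA : forall a, a \in A -> W_admissible x a /\ gains (wend a).

Lemma in_B_proposed : in_B (cap M) (inr f) (proposed f A).
Proof.
apply: in_B_restr; apply/vleP=> e; rewrite ffunE.
have [/admA[/W_admissible_firm[xe _] _]|_] := boolP (e \in A).
  by rewrite addn1.
by rewrite addn0 g_alloc_cap.
Qed.

(** The choice stays below the join of [x] and [y]: on a proposed edge that [y]
    does not increase, the refusal of one more unit above [y] persists, by (A2),
    in the presence of other offers. By (A1) it is then the choice from that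
    join, which is [y]. *)
Lemma choiceF_proposed_y :
  choiceF f (vmax (restr (inr f) y) (proposed f A)) = restr (inr f) y.
Proof.
set u := vmax _ _.
have Bu : in_B (cap M) (inr f) u.
  by apply: in_B_vmax; [apply: g_alloc_in_B | apply: in_B_proposed].
have xy_u : vle (vmax (restr (inr f) y) (restr (inr f) x)) u.
  apply/vleP=> e; rewrite !vmaxE geq_max leq_maxl /=.
  by rewrite leq_max (vleP _ _ (restr_proposed f A)) orbT.
rewrite -(precF_choiceF f); symmetry; apply: choiceF_between => //.
apply/vleP=> e; have := choiceF_leE e Bu.
have [fe|fe] := eqVneq (fend e) f; last first.
  by rewrite [u e](in_B_out Bu) // leqn0 => /eqP->.
rewrite !vmaxE proposedE // !restrE /= ?fe ?eqxx //.
have [eA|_] := boolP (e \in A); last by rewrite addn0.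
have [adm_e gain_e] := admA eA.
have [ye _|xye] := leqP (y e) (x e); last first.
  by rewrite addn1 (maxn_idPl xye).
have y1u : vle (add_unit (restr (inr f) y) e) u.
  apply/vleP=> e'; rewrite add_unitE vmaxE leq_max.
  case: (e' =P e) => [->|_]; last by rewrite addn0 leqnn.
  by rewrite proposedE // restrE /= ?fe ?eqxx // eA leq_add2r ye orbT.
have := admissible_refused adm_e gain_e ye; rewrite fe.
move/(leq_trans (choiceF_min e Bu y1u)).
rewrite add_unit_same restrE /= ?fe ?eqxx // geq_min ltnn orbF.
by move=> /leq_trans->.
Qed.

End Proposals.

(** If [f] kept all of [x] and the new unit of [a], then by (A3) its choice from
    the join with [y] would be larger than [x]; but that choice is [y], of the
    same size as [x]. So [f] drops a unit of some [c], and as [c] is cut when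
    only [a] is added to [x], (A2) bounds [y c] strictly below [x c]. *)
Lemma gains_tandem w : gains w ->
  exists a c, [/\ wend a = w, tandem x a c & y c < x c].
Proof.
move=> gain_w; have [a wa adm_a] := gains_admissible gain_w; exists a.
have [xa Ca] := W_admissible_firm adm_a.
set f := fend a in Ca; set z := add_unit (restr (inr f) x) a in Ca.
have admA a' : a' \in [:: a] -> W_admissible x a' /\ gains (wend a').
  by rewrite inE => /eqP->; rewrite wa.
have zE : proposed f [:: a] = z by exact: proposed1.
have := choiceF_proposed_y f admA; rewrite zE => Cu.
have Bz : in_B (cap M) (inr f) z by rewrite -zE; apply: in_B_proposed.
have Bu : in_B (cap M) (inr f) (vmax (restr (inr f) y) z).
  by apply: in_B_vmax => //; apply: g_alloc_in_B.
have size_Cz : vsize (choiceF f z) < vsize z.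
  rewrite vsize_add_unit ltnS firm_size_eq -Cu.
  by apply: choiceF_size => //; apply: vmaxr.
(* As [vsize z] exceeds the size of [x] by one, exactly one unit is dropped. *)
have [c Czc] : exists c, choiceF f z c < z c.
  apply/existsP; apply: contraTT size_Cz => /existsPn no_c.
  by rewrite -leqNgt; apply: leq_vsize; apply/vleP=> c; rewrite leqNgt.
have xf_Cz : vsize (restr (inr f) x) <= vsize (choiceF f z).
  have /andP[_ /eqP {1}<-] := acceptable_restr (inr f) gx.
  by apply: choiceF_size => //; rewrite -zE; apply: restr_proposed.
have fc : fend c = f.
  apply/eqP; apply: contraTT Czc => fc; by rewrite [z c](in_B_out Bz).
have ne_ca : c != a.
  apply: contraTneq Czc => ->; rewrite Ca add_unit_same restrE //= ?eqxx //.
  by rewrite ltnn.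
have zc : z c = x c by rewrite add_unitE (negPf ne_ca) addn0 restrE //= fc.
exists c; split=> //.
  rewrite /tandem adm_a fc eqxx ne_ca /=; apply/eqP; apply: vle_vsize_eq.
    apply/vleP=> e; rewrite ffunE; case: (e =P c) => [->|_]; first by rewrite addn1.
    by rewrite addn0; apply: choiceF_leE.
  by rewrite !vsize_add_unit ltnS.
have := choiceF_min c Bu (vmaxr _ _); rewrite Cu zc restrE /= ?fc ?eqxx //.
move/leq_ltn_trans; rewrite zc in Czc => /(_ _ Czc).
by rewrite gtn_min ltnn orbF.
Qed.

(** Several tandems pass [f] at once, and they do not interfere. Each [c] that is
    dropped against its own proposal is dropped, by (A2), against all of them
    together, so the joint choice lies below [x']. It has at least the size of
    [x] by (A3), which is the size of [x'], so it equals [x']. This also covers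
    an edge that would be both proposed and dropped. *)
Lemma shift_firm f (A C : seq (edge M)) (x' : vec M) :
    (forall a, a \in A -> W_admissible x a /\ gains (wend a)) ->
    (forall c, c \in C -> exists2 a, a \in A & tandem x a c) ->
    (forall e, x' e + (e \in C) = x e + (e \in A)) ->
    vsize (restr (inr f) x') = vsize (restr (inr f) x) ->
  acceptable (inr f) (restr (inr f) x') /\
  preceq (inr f) (restr (inr f) x') (restr (inr f) y).
Proof.
move=> admA tanC x'E size_x'.
have Bv := in_B_proposed f admA; set v := proposed f A in Bv.
set X' := restr (inr f) x'.
have X'v : vle X' v.
  apply/vleP=> e; rewrite ffunE; case: ifP => // /eqP fe.
  by rewrite proposedE // -x'E leq_addr.
have Cv : choiceF f v = X'.
  apply: vle_vsize_eq; last first.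
    rewrite size_x'; have /andP[_ /eqP {1}<-] := acceptable_restr (inr f) gx.
    by apply: choiceF_size => //; apply: restr_proposed.
  apply/vleP=> c; have := choiceF_leE c Bv.
  have [fc|fc] := eqVneq (fend c) f; last first.
    by rewrite [v c](in_B_out Bv) // leqn0 => /eqP->.
  rewrite proposedE // restrE /= ?fc ?eqxx // -x'E.
  have [cC _|_] := boolP (c \in C); last by rewrite addn0.
  have [a aA /and4P[_ /eqP fa ne_ca /eqP/ffunP/(_ c)]] := tanC _ cC.
  rewrite fc in fa; rewrite -fa !ffunE eqxx (negPf ne_ca) addn0 addn1 /= fc eqxx.
  move=> xc; have z_v : vle (add_unit (restr (inr f) x) a) v.
    apply/vleP=> e; rewrite add_unitE; case: (e =P a) => [->|_].
      by rewrite proposedE // restrE /= -?fa ?eqxx // aA.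
    by rewrite addn0; apply: (vleP _ _ (restr_proposed f A)).
  have := choiceF_min c Bv z_v.
  rewrite add_unitE (negPf ne_ca) addn0 restrE /= ?fc ?eqxx // -xc.
  rewrite geq_min ltnn orbF => /leq_trans-> //.
  by rewrite -ltnS xc -(addn1 (x' c)) -[X in _ + X]/(nat_of_bool true) -cC x'E leq_addr.
have BX' := in_B_le Bv X'v.
have accX' : acceptable (inr f) X'.
  rewrite /acceptable BX' /=; apply/eqP; rewrite -{2}Cv.
  by apply: choiceF_between => //; rewrite Cv; apply/vleP=> e.
split=> //; rewrite /preceq; case: eqP => //= neX'y.
rewrite /prec accX' acceptable_restr //=; move/eqP: neX'y => -> /=.
have Cu := choiceF_proposed_y f admA; apply/eqP; rewrite -{2}Cu.
apply: choiceF_between; first by apply: in_B_vmax => //; apply: g_alloc_in_B.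
  apply/vleP=> e; rewrite !vmaxE geq_max leq_maxl /=.
  by rewrite leq_max (vleP _ _ X'v) orbT.
by rewrite Cu; apply: vmaxl.
Qed.

End Comparison.

(** * From a cycle of tandems to a rotation *)

Section Cycles.

Variables (M : market) (x : vec M) (aw cw : worker M -> edge M) (s : seq (worker M)).

Definition alternation (t : seq (worker M)) : seq (Defs.arc M) :=
  flatten [seq [:: inl (aw w); inr (cw w)] | w <- t].

Lemma mem_alternation_inl t e : (inl e \in alternation t) = (e \in map aw t).
Proof. by elim: t => //= w t IH; rewrite !inE IH. Qed.

Lemma mem_alternation_inr t e : (inr e \in alternation t) = (e \in map cw t).
Proof. by elim: t => //= w t IH; rewrite !inE IH. Qed.

Lemma uniq_alternation t :
  uniq (map aw t) -> uniq (map cw t) -> uniq (alternation t).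
Proof.
elim: t => //= w t IH /andP[aw_t /IH{}IH] /andP[cw_t /IH ->].
by rewrite inE /= -/(alternation t) mem_alternation_inl mem_alternation_inr aw_t cw_t.
Qed.

Hypotheses (s_n0 : s != [::]) (us : uniq s) (cyc_s : fcycle (@wend M \o cw) s).
Hypothesis aw_end : {in s, forall w, wend (aw w) = w}.
Hypothesis aw_cw : {in s, forall w, tandem x (aw w) (cw w)}.

(** The arcs of the cycle enter each of its workers exactly once. *)
Lemma perm_cw_end : perm_eq (map (@wend M) (map cw s)) s.
Proof. by rewrite -map_comp; apply: perm_map_fcycle. Qed.

Lemma uniq_cw : uniq (map cw s).
Proof. by apply: (@map_uniq _ _ (@wend M)); rewrite (perm_uniq perm_cw_end). Qed.

Lemma map_aw_end : map (@wend M) (map aw s) = s.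
Proof. by rewrite -map_comp -[RHS]map_id; apply/eq_in_map. Qed.

Lemma uniq_aw : uniq (map aw s).
Proof. by apply: (@map_uniq _ _ (@wend M)); rewrite map_aw_end. Qed.

Lemma alternation_path w t : {subset t <= s} -> fpath (@wend M \o cw) w t ->
  path (consecutive x) (inr (cw w)) (alternation t).
Proof.
elim: t w => //= w' t IH w ts /andP[/eqP ww' /IH ->].
  have w's : w' \in s by rewrite ts ?mem_head.
  have /and4P[_ /eqP fc _ _] := aw_cw w's.
  by rewrite /consecutive /= aw_end // ww' fc aw_cw // !eqxx.
by move=> w1 w1t; rewrite ts // inE w1t orbT.
Qed.

Lemma alternation_cycle : cycle (consecutive x) (alternation s).
Proof.
have [w0 [t def_s]] : exists w t, s = rcons t w.
  by case/lastP: (s) s_n0 => // t w _; exists w, t.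
have last_alt d : last d (alternation s) = inr (cw (last w0 s)).
  by rewrite def_s /alternation map_rcons flatten_rcons last_cat last_rcons.
rewrite (cycle_path (inr (cw w0))) last_alt.
by apply: alternation_path => //; rewrite -cycle_path.
Qed.

Lemma alternation_D : {subset alternation s <= digraph_D x}.
Proof.
case=> e; rewrite ?mem_alternation_inl ?mem_alternation_inr inE.
  by case/mapP=> w /aw_cw/and4P[adm _ _ _] ->.
by case/mapP=> w /aw_cw tan_w ->; apply/existsP; exists (aw w).
Qed.

(** A worker of the cycle keeps its entering arc, so the arc leaving it is never
    removable; the arc after that is in a tandem whose first arc remains. *)
Lemma alternation_clean (D : {set Defs.arc M}) :
  {subset alternation s <= D} -> {subset alternation s <= clean_step x D}.
Proof.
move=> sD; rewrite /clean_step; case: pickP => // a /andP[_ /forallP no_enter].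
have not_a w : w \in s -> aw w != a.
  move=> ws; apply/eqP=> def_a; move: ws; rewrite -(perm_mem perm_cw_end).
  case/mapP=> c cs wc; have := no_enter (inr c); rewrite sD ?mem_alternation_inr //=.
  rewrite -def_a aw_end ?wc ?eqxx //.
  by rewrite -(perm_mem perm_cw_end) map_f.
move=> d ds; rewrite /delete_arcs !inE sD // andbT.
case: d ds => e; rewrite ?mem_alternation_inl ?mem_alternation_inr.
  by case/mapP=> w ws ->; apply: not_a.
case/mapP=> w ws ->; rewrite negb_and; apply/orP; right.
apply/forallPn; exists (aw w); rewrite negb_imply not_a // aw_cw //.
by rewrite sD ?mem_alternation_inl ?map_f.
Qed.

Lemma alternation_rotation : rotation x (alternation s).
Proof.
apply/and4P; split.
- by case: (s) s_n0.
- apply/allP; rewrite /active_graph; elim: #|_| => [|n]; first exact: alternation_D.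
  exact: alternation_clean.
- exact: uniq_alternation uniq_aw uniq_cw.
- exact: alternation_cycle.
Qed.

(** At a worker the cycle leaves as often as it enters; at a firm the arcs come in
    tandems. *)
Lemma alternation_balanced v :
  count (incident v) (map aw s) = count (incident v) (map cw s).
Proof.
case: v => [w|f].
  rewrite -[LHS](count_map (@wend M) (pred1 w)) -[RHS](count_map (@wend M) (pred1 w)).
  by rewrite map_aw_end; apply/esym/permP/perm_cw_end.
rewrite !count_map; apply: eq_in_count => w ws /=.
by have /and4P[_ /eqP -> _ _] := aw_cw ws.
Qed.

Lemma alternation_size v (x' : vec M) :
    (forall e, x' e + (e \in map cw s) = x e + (e \in map aw s)) ->
  vsize (restr v x') = vsize (restr v x).
Proof.
move=> x'E; rewrite !vsize_restr.
apply: (@addIn (\sum_(e | incident v e) (e \in map cw s))).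
rewrite -big_split /= (eq_bigr (fun e => x e + (e \in map aw s))) //.
by rewrite big_split /= !sum_mem_uniq ?uniq_aw ?uniq_cw // alternation_balanced.
Qed.

End Cycles.

Theorem proposition3p3 (M : market) (x y : vec M)
    (hx : stable x) (hy : stable y) (hxy : precF x y) :
  exists x' : vec M, shifted x x' /\ preceqF x' y.
Proof.
have gx := stable_g_alloc hx; have gy := stable_g_alloc hy.
have [e0 ne_e0] : exists e, x e != y e.
  apply/existsP; apply: contraTT hxy => /existsPn eq_xy.
  by rewrite /precF (_ : x = y) ?eqxx ?andbF //; apply/ffunP=> e; apply/eqP/negPn/eq_xy.
have gain_e0 : gains x y (wend e0).
  have [xye|yxe|eq_e0] := ltngtP (x e0) (y e0).
  - by apply/existsP; exists e0; rewrite eqxx.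
  - exact: loss_gains yxe.
  - by rewrite eq_e0 eqxx in ne_e0.
have [ac acP] : exists ac : worker M -> edge M * edge M, forall w, gains x y w ->
    [/\ wend (ac w).1 = w, tandem x (ac w).1 (ac w).2 & y (ac w).2 < x (ac w).2].
  apply: (fin_all_exists (P := fun w p => gains x y w ->
    [/\ wend p.1 = w, tandem x p.1 p.2 & y p.2 < x p.2])) => w.
  (* The pair of a worker without gains is arbitrary. *)
  have [gain_w|_] := boolP (gains x y w); last by exists (e0, e0).
  have [a [c [wa tan loss_c]]] := gains_tandem hx hy hxy gain_w.
  by exists (a, c).
pose aw w := (ac w).1; pose cw w := (ac w).2.
have next_gains w : gains x y w -> gains x y (wend (cw w)).
  by case/acP=> _ _; apply: loss_gains.
have [s [s_n0 us cyc_s /allP gain_s]] := exists_fcycle gain_e0 next_gains.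
have aw_end : {in s, forall w, wend (aw w) = w} by move=> w /gain_s/acP[].
have aw_cw : {in s, forall w, tandem x (aw w) (cw w)} by move=> w /gain_s/acP[].
pose x' : vec M := [ffun e => x e + (e \in map aw s) - (e \in map cw s)].
(* The subtraction does not truncate, since a dropped edge has [y c < x c]. *)
have x'E e : x' e + (e \in map cw s) = x e + (e \in map aw s).
  rewrite ffunE subnK //; case: mapP => // -[w /gain_s/acP[_ _ loss_c] ->].
  by apply: leq_trans (leq_addr _ _); apply: leq_ltn_trans loss_c.
have admA a : a \in map aw s -> W_admissible x a /\ gains x y (wend a).
  case/mapP=> w ws ->; have [/= wa /and4P[adm _ _ _] _] := acP _ (gain_s _ ws).
  by rewrite /aw wa gain_s.
have tanC c : c \in map cw s -> exists2 a, a \in map aw s & tandem x a c.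
  by case/mapP=> w ws ->; exists (aw w); rewrite ?map_f ?aw_cw.
have size_x' v := alternation_size us cyc_s aw_end aw_cw v x'E.
have firms f := shift_firm hx hy hxy admA tanC x'E (size_x' (inr f)).
exists x'; split.
  exists (alternation aw cw s); first exact: alternation_rotation.
  by move=> e; rewrite mem_alternation_inl mem_alternation_inr.
rewrite /preceqF; case: eqP => //= /eqP ne_x'y.
have x'_cap : vle x' (cap M).
  apply/vleP=> e; apply: leq_trans (_ : x e + (e \in map aw s) <= _).
    by rewrite -x'E leq_addr.
  have [/admA[/(W_admissible_firm hx)[xe _] _]|_] := boolP (_ \in _).
    by rewrite addn1.
  by rewrite addn0 g_alloc_cap.
rewrite /precF gy ne_x'y /=; apply/andP; split; last first.
  by apply/forallP=> f; have [] := firms f.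
rewrite /g_alloc x'_cap; apply/forallP=> -[w|f]; last by have [] := firms f.
rewrite /acceptable in_B_restr //=; apply/eqP.
by rewrite /choiceW size_x' g_alloc_quota.
Qed.
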